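(* For all real $r,s$ with $0\le r,s<1$ there is an equality $$R(ab,r,s)=\sup_{p_1/q\le r,\; p_2/q\le s}\frac{p_1+p_2+1}{q},$$ where the supremum is over all positive integers $q$ and integers $p_1,p_2$ with $p_1/q\le r$ and $p_2/q\le s$.
   Context: $F$ is the free group on two generators $a,b$. $\mathrm{Homeo}^+(S^1)^\sim$ denotes the group of increasing homeomorphisms of $\mathbb{R}$ commuting with $x\mapsto x+1$ (lifts of orientation-preserving homeomorphisms of $S^1=\mathbb{R}/\mathbb{Z}$), and $\mathrm{rot}^\sim(\varphi)=\lim_{n\to\infty}(\varphi^n(x)-x)/n\in\mathbb{R}$ is the real-valued Poincaré rotation number. For $w\in F$ and $r,s\in\mathbb{R}$, $R(w,r,s)$ denotes the supremum of $\mathrm{rot}^\sim(\rho(w))$ over all homomorphisms $\rho:F\to \mathrm{Homeo}^+(S^1)^\sim$ with $\mathrm{rot}^\sim(\rho(a))=r$ and $\mathrm{rot}^\sim(\rho(b))=s$. Here $w=ab$. *)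

(* Defs.v *)
From HB Require Import structures.
From mathcomp Require Import all_boot all_order all_algebra.
From mathcomp Require Import ring lra.
From mathcomp Require Import all_classical all_reals all_analysis.

Set Implicit Arguments.
Unset Strict Implicit.
Unset Printing Implicit Defensive.

Import Order.TTheory GRing.Theory Num.Theory.
Import numFieldNormedType.Exports.

(* The free group on T, as the group of reduced words.  The letter (x, true)
   stands for x and (x, false) for its inverse.  fg_lift, fg_lift_gen and
   fg_lift_unique give the universal property. *)
Section FreeGroup.
Variable T : choiceType.
Implicit Types (x y : T * bool) (u v w : seq (T * bool)).

Definition letter_inv x : T * bool := (x.1, ~~ x.2).
Arguments letter_inv : simpl never.

Definition reduced w : bool := sorted (fun x y => y != letter_inv x) w.

Definition push x w :=
  if w is y :: w' then if y == letter_inv x then w' else x :: w else [:: x].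

(* If v is reduced, word_mul u v is the reduced form of u ++ v. *)
Definition word_mul u v := foldr push v u.

Definition word_inv w := rev (map letter_inv w).

Lemma letter_invK : involutive letter_inv.
Proof. by case=> t e; rewrite /letter_inv /= negbK. Qed.

Lemma reduced_push x w : reduced w -> reduced (push x w).
Proof.
case: w => [//|y w] rw /=; case: ifP => [_|/negbT nyx].
  by move: rw; rewrite /reduced /=; apply: path_sorted.
by rewrite /reduced /= nyx.
Qed.

Lemma reduced_mul u v : reduced v -> reduced (word_mul u v).
Proof. by move=> rv; elim: u => //= x u; apply: reduced_push. Qed.

Lemma push_reduced x w : reduced (x :: w) -> push x w = x :: w.
Proof. by case: w => [//|y w] /= /andP[/negPf-> _]. Qed.

Lemma pushK x w : reduced w -> push x (push (letter_inv x) w) = w.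
Proof.
case: w => [_|y w] /=; first by rewrite eqxx.
rewrite letter_invK; case: eqP => [->|_ _]; last by rewrite /= eqxx.
by case: w => [//|z w] /= /andP[/negPf->].
Qed.

Lemma word_mul_push x u w :
  reduced w -> word_mul (push x u) w = push x (word_mul u w).
Proof.
move=> rw; case: u => [//|y u] /=; case: eqP => [->|_] //=.
by rewrite pushK // reduced_mul.
Qed.

Lemma word_mulA u v w :
  reduced w -> word_mul u (word_mul v w) = word_mul (word_mul u v) w.
Proof. by move=> rw; elim: u => //= x u ->; rewrite word_mul_push. Qed.

Lemma word_mulg1 w : reduced w -> word_mul w [::] = w.
Proof.
elim: w => //= x w IH rxw; rewrite IH ?push_reduced //.
exact: path_sorted rxw.
Qed.

Lemma reduced_inv w : reduced w -> reduced (word_inv w).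
Proof.
rewrite /reduced /word_inv rev_sorted sorted_map; apply: sub_sorted => x y /=.
by rewrite letter_invK eq_sym.
Qed.

Lemma word_invK : involutive word_inv.
Proof.
move=> w; rewrite /word_inv map_rev revK -map_comp map_id_in // => x _.
exact: letter_invK.
Qed.

Lemma word_mulVg w : word_mul (word_inv w) w = [::].
Proof.
elim: w => //= x w IH.
rewrite /word_inv /= rev_cons /word_mul foldr_rcons /= letter_invK eqxx.
exact: IH.
Qed.

Record freegroup := FreeGroup {
  fg_word :> seq (T * bool);
  fg_reduced : reduced fg_word
}.

HB.instance Definition _ := [isSub for fg_word].
HB.instance Definition _ := [Choice of freegroup by <:].

Implicit Types g h : freegroup.

Definition fg_one : freegroup := @FreeGroup [::] isT.
Definition fg_mul g h : freegroup :=
  FreeGroup (reduced_mul g (fg_reduced h)).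
Definition fg_inv g : freegroup := FreeGroup (reduced_inv (fg_reduced g)).
Definition fg_gen (t : T) : freegroup := @FreeGroup [:: (t, true)] isT.

Lemma fg_mulA : associative fg_mul.
Proof. by move=> f g h; apply/val_inj/word_mulA/fg_reduced. Qed.

Lemma fg_mul1g : left_id fg_one fg_mul.
Proof. by move=> g; apply/val_inj. Qed.

Lemma fg_mulg1 : right_id fg_one fg_mul.
Proof. by move=> g; apply/val_inj/word_mulg1/fg_reduced. Qed.

Lemma fg_mulVg : left_inverse fg_one fg_inv fg_mul.
Proof. by move=> g; apply/val_inj/word_mulVg. Qed.

Lemma fg_mulgV : right_inverse fg_one fg_inv fg_mul.
Proof.
move=> g; apply/val_inj => /=.
by rewrite -[X in word_mul X]word_invK word_mulVg.
Qed.

HB.instance Definition _ :=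
  isGroup.Build freegroup fg_mulA fg_mul1g fg_mulg1 fg_mulVg fg_mulgV.

Section Lift.
Variables (G : groupType) (f : T -> G).
Local Open Scope group_scope.

Definition letter_lift x : G := if x.2 then f x.1 else (f x.1)^-1.

Definition fg_lift g : G :=
  foldr (fun x acc => letter_lift x * acc) 1 (fg_word g).

Lemma fg_liftM g h : fg_lift (g * h) = fg_lift g * fg_lift h.
Proof.
rewrite /fg_lift /=; elim: (fg_word g) => [|x u IH] /=; first by rewrite mul1g.
rewrite -mulgA -IH; case: (word_mul u h) => [//|y w] /=.
case: eqP => [->|_] //=; rewrite mulgA /letter_lift /letter_inv /=.
by case: x.2; rewrite /= (mulgV, mulVg) mul1g.
Qed.

Lemma fg_lift1 : fg_lift 1 = 1.
Proof. by []. Qed.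

HB.instance Definition _ := isUMagmaMorphism.Build freegroup G fg_lift
  (fg_lift1, fg_liftM).

Lemma fg_lift_gen t : fg_lift (fg_gen t) = f t.
Proof. by rewrite /fg_lift /= mulg1. Qed.

Lemma fg_lift_unique (rho : UMagmaMorphism.type freegroup G) :
  (forall t, rho (fg_gen t) = f t) -> rho =1 fg_lift.
Proof.
move=> rhoE [w rw]; rewrite /fg_lift /=.
elim: w rw => [|[t e] w IH] rw /=.
  by rewrite (_ : FreeGroup rw = 1) ?gmulf1 //; exact/val_inj.
have rw' : reduced w := path_sorted rw.
have -> : FreeGroup rw = (if e then fg_gen t else (fg_gen t)^-1) * FreeGroup rw'.
  by apply/val_inj => /=; case: e rw => rw /=; rewrite push_reduced.
by rewrite gmulfM IH /letter_lift; case: e {rw} => /=; rewrite ?gmulfV rhoE.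
Qed.

End Lift.
End FreeGroup.

Notation F2 := (freegroup bool).
Definition gen_a : F2 := fg_gen true.
Definition gen_b : F2 := fg_gen false.

Section LiftedHomeo.
Variable R : realType.
Local Open Scope ring_scope.

(* Increasing homeomorphisms of the line commuting with x |-> x + 1; the
   inverse is a field, but it is determined by the map (lifthomeo_inj). *)
Record lifthomeo := LiftHomeo {
  lh_fun :> R -> R;
  lh_inv : R -> R;
  lh_funK : cancel lh_fun lh_inv;
  lh_invK : cancel lh_inv lh_fun;
  lh_cont : continuous lh_fun;
  lh_inv_cont : continuous lh_inv;
  lh_incr : {homo lh_fun : x y / x < y};
  lh_add1 : forall x, lh_fun (x + 1) = lh_fun x + 1
}.

Implicit Types f g h : lifthomeo.

Lemma lifthomeo_inj f g : lh_fun f = lh_fun g -> f = g.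
Proof.
case: f g => [f f' fK f'K cf cf' if_ f1] [g g' gK g'K cg cg' ig g1] /= Efg.
subst g.
have E : f' = g' by apply/funext => x; rewrite -[x in LHS]g'K fK.
by subst g'; congr LiftHomeo; exact: Prop_irrelevance.
Qed.

HB.instance Definition _ := gen_eqMixin lifthomeo.
HB.instance Definition _ := gen_choiceMixin lifthomeo.

Definition lh_one : lifthomeo.
Proof.
by refine (@LiftHomeo id id _ _ _ _ _ _) => // x; exact: cvg_id.
Defined.

(* Product of homeomorphisms: (f * g)(x) = f (g x). *)
Definition lh_mul f g : lifthomeo.
Proof.
refine (@LiftHomeo (f \o g) (lh_inv g \o lh_inv f) _ _ _ _ _ _).
- exact: can_comp (@lh_funK f) (@lh_funK g).
- exact: can_comp (@lh_invK g) (@lh_invK f).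
- by move=> x; apply: continuous_comp; exact: lh_cont.
- by move=> x; apply: continuous_comp; exact: lh_inv_cont.
- by move=> x y /(@lh_incr g)/(@lh_incr f).
- by move=> x /=; rewrite !lh_add1.
Defined.

Definition lh_inverse f : lifthomeo.
Proof.
refine (@LiftHomeo (lh_inv f) f (@lh_invK f) (@lh_funK f)
  (@lh_inv_cont f) (@lh_cont f) _ _).
- move=> x y; apply: contraTT; rewrite -!leNgt le_eqVlt => /orP[/eqP E|].
    by rewrite -[x](@lh_invK f) -[y](@lh_invK f) E.
  by move=> /(@lh_incr f); rewrite !lh_invK; exact: ltW.
- by move=> x; apply: (can_inj (@lh_funK f)); rewrite lh_add1 !lh_invK.
Defined.

Lemma lh_mulA : associative lh_mul.
Proof. by move=> f g h; apply: lifthomeo_inj. Qed.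

Lemma lh_mul1g : left_id lh_one lh_mul.
Proof. by move=> f; apply: lifthomeo_inj. Qed.

Lemma lh_mulg1 : right_id lh_one lh_mul.
Proof. by move=> f; apply: lifthomeo_inj. Qed.

Lemma lh_mulVg : left_inverse lh_one lh_inverse lh_mul.
Proof. by move=> f; apply/lifthomeo_inj/funext => x /=; rewrite lh_funK. Qed.

Lemma lh_mulgV : right_inverse lh_one lh_inverse lh_mul.
Proof. by move=> f; apply/lifthomeo_inj/funext => x /=; rewrite lh_invK. Qed.

HB.instance Definition _ :=
  isGroup.Build lifthomeo lh_mulA lh_mul1g lh_mulg1 lh_mulVg lh_mulgV.

Local Open Scope classical_set_scope.

Definition rot_seq (phi : lifthomeo) (x : R) : R^nat :=
  fun n => ((phi ^+ n)%g x - x) / n%:R.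

(* rot_cvg below shows that the base point 0 plays no role. *)
Definition rot (phi : lifthomeo) : R := limn (rot_seq phi 0).

Lemma lh_addn f x n : f (x + n%:R) = f x + n%:R.
Proof.
elim: n => [|n IH]; first by rewrite !addr0.
by rewrite -natr1 !addrA lh_add1 IH.
Qed.

Lemma lh_addz f x (m : int) : f (x + m%:~R) = f x + m%:~R.
Proof.
case: m => n; first exact: lh_addn.
rewrite NegzE mulrNz; apply: (addIr (n.+1%:R)).
by rewrite -lh_addn !subrK.
Qed.

Lemma lh_displacement f x : `|f x - x - f 0| <= 1.
Proof.
have incr y z : y <= z -> f y <= f z.
  by rewrite le_eqVlt => /orP[/eqP->//|/(@lh_incr f)/ltW].
have /andP[le_x lt_x] := mem_rg1_floor x.
set m := Num.floor x in le_x lt_x.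
have xE : x = (x - m%:~R) + m%:~R by rewrite subrK.
rewrite xE lh_addz; set t := x - m%:~R.
have t0 : 0 <= t by rewrite subr_ge0.
have t1 : t <= 1 by rewrite lerBlDl ltW // -[1]/(1%:~R) -intrD.
have := incr _ _ t0; have := incr _ _ t1.
rewrite -[in f 1](add0r 1) lh_add1 ler_norml.
by move=> *; apply/andP; split; lra.
Qed.

Lemma lh_expS f n x : (f ^+ n.+1)%g x = f ((f ^+ n)%g x).
Proof. by rewrite expgS. Qed.

Let orb f n := (f ^+ n)%g 0.

Lemma orbD f m n : `|orb f (m + n) - orb f m - orb f n| <= 1.
Proof.
have -> : orb f (m + n) = (f ^+ n)%g (orb f m).
  by rewrite /orb addnC expgnDr.
exact: lh_displacement.
Qed.

Lemma orbM f m n : `|orb f (m * n) - m%:R * orb f n| <= m%:R.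
Proof.
elim: m => [|m IH]; first by rewrite mul0n mul0r subr0 /orb normr0.
rewrite mulSn -natr1 addnC mulrDl mul1r.
have -> : orb f (m * n + n) - (m%:R * orb f n + orb f n) =
  (orb f (m * n) - m%:R * orb f n) +
  (orb f (m * n + n) - orb f (m * n) - orb f n) by ring.
by rewrite (le_trans (ler_normD _ _)) // lerD // orbD.
Qed.

Lemma rot_seq_cauchy f m n :
  `|rot_seq f 0 m.+1 - rot_seq f 0 n.+1| <= m.+1%:R^-1 + n.+1%:R^-1.
Proof.
have m0 : 0 < m.+1%:R :> R by rewrite ltr0n.
have n0 : 0 < n.+1%:R :> R by rewrite ltr0n.
rewrite /rot_seq !subr0 -/(orb f m.+1) -/(orb f n.+1).
have := orbM f m.+1 n.+1; have := orbM f n.+1 m.+1; rewrite mulnC.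
set A := orb f (_ * _) => h1 h2.
have -> : orb f m.+1 / m.+1%:R - orb f n.+1 / n.+1%:R =
  ((A - m.+1%:R * orb f n.+1) - (A - n.+1%:R * orb f m.+1))
  / (m.+1%:R * n.+1%:R) by field; rewrite !gt_eqF.
have -> : m.+1%:R^-1 + n.+1%:R^-1 = (m.+1%:R + n.+1%:R) / (m.+1%:R * n.+1%:R) :> R.
  by field; rewrite !gt_eqF.
rewrite normrM [X in _ * X <= _]gtr0_norm ?invr_gt0 ?mulr_gt0 //.
rewrite ler_pM2r ?invr_gt0 ?mulr_gt0 //.
by rewrite (le_trans (ler_normB _ _)) // lerD.
Qed.

Lemma rot_cvg phi x : rot_seq phi x @ \oo --> rot phi.
Proof.
have inv0 : (fun n : nat => n%:R^-1 : R) @ \oo --> (0 : R).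
  by rewrite -cvg_shiftS; exact: cvg_harmonic.
have cv0 : cvgn (rot_seq phi 0).
  apply/cauchy_cvgP/cauchy_exP => e e0.
  have e2 : 0 < e / 2 by rewrite divr_gt0.
  have [N _ ltN] := cvgr_lt 0 inv0 _ e2.
  exists (rot_seq phi 0 N.+1), N.+1 => // -[//|n] /= leNn.
  rewrite /ball /= (le_lt_trans (rot_seq_cauchy _ _ _)) //.
  by rewrite [e]splitr ltrD ?ltN //= ltnW.
rewrite (_ : rot_seq phi x = rot_seq phi 0 \+ (rot_seq phi x \- rot_seq phi 0)).
  rewrite -[rot phi]addr0; apply: cvgD => //.
  apply/norm_cvg0P.
  apply: (@squeeze_cvgr _ _ _ _ (fun=> 0) (fun n : nat => n%:R^-1)) => //.
    apply: nearW => n; rewrite normr_ge0 /= /rot_seq subr0 -mulrBl normrM.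
    rewrite normfV normr_nat ler_piMl ?invr_ge0 //.
    exact: lh_displacement.
  exact: cvg_cst.
by apply/funext => n /=; rewrite addrC subrK.
Qed.

(* The supremum is taken in the extended reals, so that no default value for
   empty or unbounded sets intervenes. *)
Definition maxrot (w : F2) (r s : R) : \bar R :=
  ereal_sup [set (rot (rho w))%:E | rho in
    [set rho : UMagmaMorphism.type F2 lifthomeo |
      rot (rho gen_a) = r /\ rot (rho gen_b) = s]].

End LiftedHomeo.

(* Main.v *)
Require Import Defs.
From mathcomp Require Import all_boot all_order all_algebra.
From mathcomp Require Import zify ring lra.
From mathcomp Require Import all_classical all_reals all_analysis.
Import Order.TTheory GRing.Theory Num.Theory.
Import numFieldNormedType.Exports.
Local Open Scope classical_set_scope.
Local Open Scope ring_scope.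

(* Upper bound.  Subtracting a constant from rho(a) we may assume that the product
   f g has an exact periodic orbit z_i, ordered so that z_(i+q) = z_i + 1 and
   f (g (z_i)) = z_(i+p).  Put w_i = g (z_i) and G i = max {j | z_j <= w_i}.  If G
   is onto it is a translation by some k, so the z_i and w_i are interlaced in the
   simplest way, g advances the z_i by at least k steps, f advances the w_i by at
   least p - k - 1 steps, and the bound holds with denominator q.  Otherwise g can
   be enlarged, at the cost of its continuity but not of its rotation number, so
   that the product has a periodic orbit of smaller period and at least the same
   rotation number; induct on q.  Discontinuity forces the induction to run over
   monotone degree one maps of the line rather than homeomorphisms.

   Lower bound.  Take f preserving the points i/q and g preserving the points
   (i + 1/2)/q, each moving the points in between almost one step further; then
   raise the rotation numbers of f and g to r and s by adding constants. *)

(** * Monotone degree one maps and the growth of their orbits *)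

Definition degree_one {R : realType} (f : R -> R) : Prop :=
  {homo f : x y / x <= y} /\ forall x, f (x + 1) = f x + 1.

(* For a degree one map this says that its rotation number is at most [r]. *)
Definition rot_ub {R : realType} (f : R -> R) (r : R) : Prop :=
  forall x, exists C, forall n, iter n f x <= n%:R * r + C.

Lemma degree_one_comp {R : realType} (f g : R -> R) :
  degree_one f -> degree_one g -> degree_one (f \o g).
Proof.
move=> [fm f1] [gm g1]; split=> [x y xy | x] /=; last by rewrite g1 f1.
exact/fm/gm.
Qed.

Lemma degree_one_iter {R : realType} (f : R -> R) (n : nat) :
  degree_one f -> degree_one (iter n f).
Proof.
move=> [fm f1]; split=> [x y xy | x]; elim: n => //= n IH.
- exact: fm.
- by rewrite IH f1.
Qed.

Lemma degree_one_addn {R : realType} (f : R -> R) (x : R) (n : nat) :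
  degree_one f -> f (x + n%:R) = f x + n%:R.
Proof.
move=> [_ f1]; elim: n => [|n IH]; first by rewrite !addr0.
by rewrite -natr1 !addrA f1 IH.
Qed.

Lemma degree_one_addz {R : realType} (f : R -> R) (x : R) (m : int) :
  degree_one f -> f (x + m%:~R) = f x + m%:~R.
Proof.
move=> f1; case: m => n; first exact: degree_one_addn.
rewrite NegzE mulrNz; apply: (addIr (n.+1%:R)).
by rewrite -degree_one_addn // !subrK.
Qed.

Lemma le_iter_homo {R : realType} (f g : R -> R) (x y : R) (n : nat) :
  {homo g : x y / x <= y} -> (forall x, f x <= g x) -> x <= y ->
  iter n f x <= iter n g y.
Proof.
move=> gm fg xy; elim: n => //= n IH.
by apply: le_trans (fg _) _; apply: gm.
Qed.

Lemma iter_le {R : realType} (f : R -> R) (x : R) (n : nat) :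
  {homo f : x y / x <= y} -> f x <= x -> iter n f x <= x.
Proof. by move=> fm fx; elim: n => //= n IH; apply: le_trans fx; apply: fm. Qed.

Lemma iter_ge {R : realType} (f : R -> R) (x : R) (n : nat) :
  {homo f : x y / x <= y} -> x <= f x -> x <= iter n f x.
Proof. by move=> fm fx; elim: n => //= n IH; apply: le_trans fx _; apply: fm. Qed.

(** Under a monotone map an orbit moves in one direction only, so an orbit that returns to its start
    never left it. *)
Lemma fixed_of_iter_fixed {R : realType} (f : R -> R) (x : R) (n : nat) :
  {homo f : x y / x <= y} -> iter n.+1 f x = x -> f x = x.
Proof.
move=> fm E; apply/le_anti/andP; split.
  case/orP: (le_total (f x) x) => // fx.
  by have := iter_ge f (f x) n fm (fm _ _ fx); rewrite -iterSr E.
case/orP: (le_total x (f x)) => // fx.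
by have := iter_le f (f x) n fm (fm _ _ fx); rewrite -iterSr E.
Qed.

Lemma iter_addz_ge {R : realType} (f : R -> R) (x : R) (q : nat) (p : int) (n : nat) :
  degree_one f -> x + p%:~R <= iter q f x ->
  x + (n%:Z * p)%:~R <= iter (n * q) f x.
Proof.
move=> f1 fx; elim: n => [|n IH]; first by rewrite mul0r addr0.
have fq1 := degree_one_iter f q f1.
rewrite mulSn iterD (_ : n.+1%:Z * p = n%:Z * p + p); last by lia.
apply: (le_trans _ (fq1.1 _ _ IH)).
by rewrite degree_one_addz // intrD; lra.
Qed.

Lemma iter_addz_le {R : realType} (f : R -> R) (x : R) (q : nat) (p : int) (n : nat) :
  degree_one f -> iter q f x <= x + p%:~R ->
  iter (n * q) f x <= x + (n%:Z * p)%:~R.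
Proof.
move=> f1 fx; elim: n => [|n IH]; first by rewrite mul0r addr0.
have fq1 := degree_one_iter f q f1.
rewrite mulSn iterD (_ : n.+1%:Z * p = n%:Z * p + p); last by lia.
apply: (le_trans (fq1.1 _ _ IH)).
by rewrite degree_one_addz // intrD; lra.
Qed.

Lemma iter_addz {R : realType} (f : R -> R) (x : R) (q : nat) (p : int) (n : nat) :
  degree_one f -> iter q f x = x + p%:~R ->
  iter (n * q) f x = x + (n%:Z * p)%:~R.
Proof.
move=> f1 fx; apply/le_anti; rewrite iter_addz_le ?fx //=.
by rewrite iter_addz_ge ?fx.
Qed.

Lemma le_of_nat_mul {R : realType} (a b C : R) :
  (forall n : nat, n%:R * a <= n%:R * b + C) -> a <= b.
Proof.
move=> H; rewrite leNgt; apply/negP => ba.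
have := unstable.ltr_bound (C / (a - b)).
rewrite ltr_pdivrMr ?subr_gt0 //.
by have := H (Num.bound (C / (a - b))); lra.
Qed.

(** One orbit controls all others: any starting point lies below [x + m] for some natural [m], and
    the iterates commute with that translation. *)
Lemma rot_ub_of_orbit {R : realType} (f : R -> R) (r x C : R) :
  degree_one f -> (forall n, iter n f x <= n%:R * r + C) -> rot_ub f r.
Proof.
move=> f1 H y; pose m := Num.bound (y - x).
exists (C + m%:R) => n; have fn1 := degree_one_iter f n f1.
rewrite addrA; apply: (le_trans _ (lerD (H n) (lexx m%:R))).
rewrite -degree_one_addn //; apply: fn1.1.
by have := unstable.ltr_bound (y - x); rewrite -/m; lra.
Qed.

Lemma rot_ub_ge {R : realType} (f : R -> R) (r x : R) (q : nat) (p : int) :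
  degree_one f -> rot_ub f r -> (0 < q)%N -> x + p%:~R <= iter q f x ->
  p%:~R / q%:R <= r.
Proof.
move=> f1 fr q0 fx; rewrite ler_pdivrMr ?ltr0n //.
have [C H] := fr x.
apply: (@le_of_nat_mul _ _ _ (C - x)) => n.
have := le_trans (iter_addz_ge f x q p n f1 fx) (H _).
by rewrite natrM intrM; lra.
Qed.

(** * Periodic sequences indexed by the integers *)

Lemma int_threshold (P : int -> bool) (a b : int) :
  P a -> ~~ P b -> a <= b -> exists j, P j && ~~ P (j + 1).
Proof.
move=> Pa Pb ab.
have exP : exists n : nat, ~~ P (a + n%:Z).
  by exists `|b - a|%N; rewrite (_ : a + _ = b) //; lia.
case: (ex_minnP exP) => -[|n] Pn nmin; first by rewrite addr0 Pa in Pn.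
exists (a + n%:Z); apply/andP; split.
  by apply/negPn/negP => /nmin; rewrite ltnn.
by rewrite -addrA -[X in _ + (_ + X)]/(1%:Z) -PoszD addn1.
Qed.

Lemma int_steps_le {R : realType} (z : int -> R) :
  (forall i, z i < z (i + 1)) -> {mono z : i j / i <= j}.
Proof.
move=> zS; apply: le_mono => i j ij.
have -> : j = i + (`|j - i|.-1).+1%:Z by lia.
elim: `|j - i|.-1 => [|n IH]; first exact: zS.
apply: lt_trans IH _.
by rewrite (_ : i + n.+2%:Z = i + n.+1%:Z + 1) //; lia.
Qed.

Lemma periodic_addz {R : realType} (z : int -> R) (q : nat) (i c : int) :
  (forall i, z (i + q%:Z) = z i + 1) -> z (i + c * q%:Z) = z i + c%:~R.
Proof.
move=> zq; have H (n : nat) j : z (j + n%:Z * q%:Z) = z j + n%:R.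
  elim: n => [|n IH]; first by rewrite mul0r !addr0.
  by rewrite -natr1 addrA -IH -zq; congr (z _); lia.
case: c => n; first exact: H.
rewrite NegzE mulrNz; apply: (addIr n.+1%:R); rewrite subrK -H.
by congr (z _); lia.
Qed.

(** [F v] is the last index with [z j <= v]; it exists because periodicity makes [z] unbounded in
    both directions. The Galois connection is the form from which monotonicity and equivariance are
    read off later. *)
Lemma periodic_floor {R : realType} (z : int -> R) (q : nat) :
  (forall i, z i < z (i + 1)) -> (forall i, z (i + q%:Z) = z i + 1) ->
  exists F : R -> int, forall v j, (j <= F v) = (z j <= v).
Proof.
move=> zS zq; have zm := int_steps_le z zS.
suff H v : exists k, forall j, (j <= k) = (z j <= v).
  by have [F HF] := choice H; exists F.
have [a Pa] : exists a, z a <= v.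
  exists ((Num.floor (v - z 0)) * q%:Z); have := floor_itv (v - z 0).
  by have := periodic_addz z q 0 (Num.floor (v - z 0)) zq; rewrite add0r => ->; lra.
have [b Pb] : exists b, ~~ (z b <= v).
  exists ((Num.floor (v - z 0) + 1) * q%:Z); have := floor_itv (v - z 0).
  have := periodic_addz z q 0 (Num.floor (v - z 0) + 1) zq; rewrite add0r => ->.
  by rewrite -ltNge; lra.
have ab : a <= b.
  by rewrite -zm; move: Pb; rewrite -ltNge => /(le_lt_trans Pa)/ltW.
have [k /andP[k1 k2]] := int_threshold (fun j => z j <= v) a b Pa Pb ab.
exists k => j; apply/idP/idP => [jk|zj].
  by apply: le_trans k1; rewrite zm.
rewrite leNgt; apply/negP => kj; case/negP: k2; apply: le_trans zj.
by rewrite zm; lia.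
Qed.

Lemma periodic_ceil {R : realType} (z : int -> R) (q : nat) :
  (forall i, z i < z (i + 1)) -> (forall i, z (i + q%:Z) = z i + 1) ->
  exists F : R -> int, forall v j, (F v <= j) = (v <= z j).
Proof.
move=> zS zq.
have [||F HF] := @periodic_floor _ (fun i => - z (- i)) q.
- by move=> i; rewrite ltrN2 (_ : - i = - (i + 1) + 1) ?zS //; lia.
- move=> i; have := zq (- (i + q%:Z)); rewrite (_ : _ + q%:Z = - i); last by lia.
  by move=> ->; lra.
exists (fun v => - F (- v)) => v j.
by rewrite lerNl HF opprK lerN2.
Qed.

(** A monotone map onto the integers never jumps by more than 1, while periodicity prescribes a
    total gain equal to the length between [- n q] and [n q]. Hence no step can fall short of 1
    either. *)
Lemma surjective_periodic_translation (G : int -> int) (q : nat) :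
  (0 < q)%N -> {homo G : i j / i <= j} -> (forall i, G (i + q%:Z) = G i + q%:Z) ->
  (forall c, exists a, G a = c) -> forall i, G i = i + G 0.
Proof.
move=> q0 Gm Gq Gs.
have GS i : G (i + 1) <= G i + 1.
  rewrite leNgt; apply/negP => lt; have [a Ga] := Gs (G i + 1).
  have [ai|ia] := leP a i; first by have := Gm _ _ ai; lia.
  have /Gm : i + 1 <= a by lia.
  by lia.
have D i (n : nat) : G (i + n%:Z) <= G i + n%:Z.
  elim: n => [|n IH]; first by rewrite !addr0.
  have := GS (i + n%:Z); rewrite (_ : i + n.+1%:Z = i + n%:Z + 1); last by lia.
  by set u := G (_ + 1); set v := G (i + _) in IH *; lia.
have P (n : nat) i : G (i + n%:Z * q%:Z) = G i + n%:Z * q%:Z.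
  elim: n => [|n IH]; first by rewrite !mul0r !addr0.
  rewrite (_ : i + n.+1%:Z * q%:Z = i + n%:Z * q%:Z + q%:Z); last by lia.
  by rewrite Gq IH; lia.
move=> i; set n := `|i|%N.
have l1 : i <= n%:Z * q%:Z by nia.
have l2 : - (n%:Z * q%:Z) <= i by nia.
have P1 := P n 0; have P2 := P n (- (n%:Z * q%:Z)).
have D' j k : j <= k -> G k <= G j + (k - j).
  by move=> jk; have := D j `|k - j|%N; rewrite gez0_abs ?subr_ge0 // [X in G X]addrC subrK.
have := D' _ _ l1; have := D' _ _ l2.
by move: P1 P2; rewrite addNr add0r => -> ->; lia.
Qed.

Lemma eq_int_mod_eq (i j q : int) : (i %% q)%Z = (j %% q)%Z ->
  i = j + ((i %/ q)%Z - (j %/ q)%Z) * q.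
Proof. by have := divz_eq i q; have := divz_eq j q; lia. Qed.

(* The iterates E 0, ..., E^q 0 fall in fewer than q residue classes. *)
Lemma periodic_point_missing_class (E : int -> int) (q : nat) (c : int) :
  (0 < q)%N -> (forall a k, E a <> c + k * q%:Z) ->
  exists i k, exists2 m : nat, (0 < m < q)%N & iter m E i = i + k * q%:Z.
Proof.
case: q => // q _ miss; set Q := q.+1.
pose res (i : int) : 'I_Q := inord `|(i %% Q%:Z)%Z|%N.
have resE i j : res i = res j -> (i %% Q%:Z)%Z = (j %% Q%:Z)%Z.
  move=> /(congr1 val) /=.
  have h t : (`|(t %% Q%:Z)%Z| < Q)%N.
    by have := modz_ge0 t (isT : Q%:Z != 0); have := ltz_pmod t (isT : 0 < Q%:Z); lia.
  rewrite !inordK ?h //.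
  have := modz_ge0 i (isT : Q%:Z != 0); have := modz_ge0 j (isT : Q%:Z != 0); lia.
(* The exponent starts at 1 so that every value lies in the image of [E], which misses the class of
   [c]. An injective [F] would be onto. *)
pose F (a : 'I_Q) := res (iter a.+1 E 0).
have : ~ injective F.
  move=> /injF_onto /(_ (res c)) /codomP[a].
  move=> /esym/resE/eq_int_mod_eq; exact: miss.
move=> /injectiveP /injectivePn [a [b ab Fab]].
wlog lt_ab : a b ab Fab / (a < b)%N.
  move=> H; have [lt|lt|/val_inj eq] := ltngtP a b; first exact: (H a b).
    by apply: (H b a) => //; rewrite eq_sym.
  by rewrite eq eqxx in ab.
have := eq_int_mod_eq _ _ _ (resE _ _ (esym Fab)).
set k := (X in X * _) => Ek.
exists (iter a.+1 E 0), k, (b - a)%N.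
  by rewrite subn_gt0 lt_ab /=; have := ltn_ord b; lia.
by rewrite -iterD (_ : (b - a + a.+1 = b.+1)%N) //; lia.
Qed.

(** * Periodic orbits of compositions of degree one maps *)

(** Coprimality gives [n p = m q + 1], so [y = h^n - m] behaves on the orbit of [x] like rotation by
    [1/q]: it moves each point to the next one, and [h] acts there as [y^p]. *)
Lemma rotation_orbit {R : realType} (h : R -> R) (x : R) (p q : nat) :
  degree_one h -> (0 < p)%N -> (0 < q)%N -> coprime p q ->
  iter q h x = x + p%:R ->
  exists z : int -> R, [/\ forall i, z i < z (i + 1),
    forall i, z (i + q%:Z) = z i + 1 & forall i, h (z i) = z (i + p%:Z)].
Proof.
move=> h1 p0 q0 /(coprimeP _ p0)[[n m] /= nm] hx.
have {}nm : (n * p = m * q + 1)%N by lia.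
pose y v := iter n h v - m%:R.
have hn1 k := degree_one_iter h k h1.
have y1 : degree_one y.
  split=> [u v uv | v]; rewrite /y; first by rewrite lerD2r; apply: (hn1 n).1.
  by rewrite (hn1 n).2; lra.
have iter_y k v : iter k y v = iter (k * n) h v - (k * m)%:R.
  elim: k => [|k IH]; first by rewrite subr0.
  rewrite iterS IH /y; have := degree_one_addz _ (iter (k * n) h v) (- (k * m)%:Z) (hn1 n).
  rewrite mulrNz => ->; rewrite mulSn iterD mulSn natrD.
  by rewrite -[(k * m)%:Z%:~R]/((k * m)%:R); lra.
have hqx k : iter (k * q) h x = x + (k * p)%:R.
  by rewrite (iter_addz h x q p%:Z k).
have yq : iter q y x = x + 1.
  by rewrite iter_y mulnC hqx nm mulnC natrD; lra.
have hy j : h (iter j y x) = iter (j + p) y x.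
  rewrite !iter_y mulnDl iterD.
  rewrite [(p * n)%N]mulnC nm addn1 iterS hqx degree_one_addn // degree_one_addn; last exact: hn1.
  have := degree_one_addz _ (iter (j * n) h x) (- (j * m)%:Z) h1.
  rewrite mulrNz => ->; rewrite -iterS iterSr mulnDl natrD.
  by rewrite [(p * m)%N]mulnC -pmulrn; ring.
(* If [y] failed to increase at [y^j x], neither would [y^q], which adds 1 there. *)
have yS j : iter j y x < iter j.+1 y x.
  rewrite ltNge iterS; apply/negP => /(iter_le _ _ q y1.1).
  rewrite -iterD addnC iterD yq.
  by rewrite (degree_one_iter y j y1).2 => ?; lra.
(* Periodic extension of [y^j x], [0 <= j < q], to negative indices, where [y] cannot be
   iterated. *)
pose z (i : int) := iter `|(i %% q)%Z|%N y x + (i %/ q)%Z%:~R.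
have q0' : q%:Z != 0 by lia.
have zn (k : nat) : z k = iter k y x.
  rewrite /z modz_nat divz_nat /= -degree_one_addz; last exact: degree_one_iter.
  have := iter_addz y x q 1 (k %/ q) y1 yq; rewrite mulr1 => <-.
  by rewrite -iterD addnC -divn_eq.
have zq i : z (i + q%:Z) = z i + 1.
  by rewrite /z modzDr divzDr // divzz q0' intrD addrA.
(* Each required property is invariant under shifts by multiples of [q], so natural indices
   suffice. *)
have ext (P : int -> Prop) : (forall i c, P i -> P (i - c * q%:Z)) ->
    (forall k : nat, P k) -> forall i, P i.
  move=> Psh Pn i; have e : i = (i + `|i|%:Z * q%:Z) - `|i|%:Z * q%:Z by lia.
  rewrite e; apply: Psh.
  by rewrite (_ : i + _ = `|(i + `|i|%:Z * q%:Z)%R|%N); [exact: Pn | nia].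
exists z; split => //; apply: ext.
- move=> i c zi; rewrite -mulNr -addrA [_ + 1]addrC addrA.
  by rewrite !(periodic_addz z q _ _ zq) ltrD2r.
- by move=> k; rewrite -[(k%:Z + 1)]/(Posz k + 1%:Z) -PoszD addn1 !zn.
- move=> i c zi; rewrite -mulNr -addrA [_ + p%:Z]addrC addrA.
  by rewrite !(periodic_addz z q _ _ zq) degree_one_addz // zi.
- by move=> k; rewrite -PoszD !zn hy.
Qed.

(* The enlarged map is [v |-> w (G (C v))], where [C v] is the least [a] with
   [v <= w a]: its orbit of [w 0] is indexed by that of [0] under [G], and its
   image misses the classes modulo [q] missed by [G]. *)
Lemma translation_or_shorter_orbit {R : realType} (f g : R -> R) (s : R)
    (z : int -> R) (q : nat) (p : int) :
  degree_one f -> degree_one g -> rot_ub g s -> (0 < q)%N ->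
  (forall i, z i < z (i + 1)) -> (forall i, z (i + q%:Z) = z i + 1) ->
  (forall i, f (g (z i)) = z (i + p)) ->
  (exists k, forall i, z (i + k) <= g (z i) < z (i + k + 1)) \/
  exists g' y (m : nat) (p' : int),
    [/\ degree_one g', rot_ub g' s, (0 < m < q)%N,
        iter m (f \o g') y = y + p'%:~R & p * m%:Z <= p' * q%:Z].
Proof.
move=> f1 g1 gs q0 zS zq fgz.
have zm := int_steps_le z zS.
pose w i := g (z i).
have wq i : w (i + q%:Z) = w i + 1 by rewrite /w zq g1.2.
(* [g] is only weakly monotone; strictness comes from [f (w i) = z (i + p)], which is strictly
   increasing in [i]. *)
have wS i : w i < w (i + 1).
  rewrite ltNge; apply/negP => /(f1.1); rewrite /w !fgz leNgt.
  by rewrite addrAC zS.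
have wm := int_steps_le w wS.
have [F HF] := periodic_floor z q zS zq.
have [C HC] := periodic_ceil w q wS wq.
pose G i := F (w i).
have GP i j : (j <= G i) = (z j <= w i) by rewrite /G HF.
have Gm : {homo G : i j / i <= j}.
  by move=> i j ij; rewrite GP; apply: (@le_trans _ _ (w i)); rewrite ?wm // -GP.
have periodic_le (A B : int) : (forall j, (j <= A) = (j <= B)) -> A = B.
  by move=> AB; apply/le_anti/andP; split; [rewrite -AB | rewrite AB].
have periodic_ge (A B : int) : (forall j, (A <= j) = (B <= j)) -> A = B.
  by move=> AB; apply/le_anti/andP; split; [rewrite AB | rewrite -AB].
have Gq i : G (i + q%:Z) = G i + q%:Z.
  apply: periodic_le => j; rewrite GP wq -[in RHS]lerBlDr GP -[in LHS]lerBlDr.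
  by have := zq (j - q%:Z); rewrite subrK => ->; rewrite addrK.
have [[c Gc]|Gonto] := pselect (exists c, forall a, G a <> c); last first.
  left; exists (G 0) => i.
  have Gs c : exists a, G a = c.
    by apply: contrapT => H; apply: Gonto; exists c => a E; apply: H; exists a.
  have Gi := surjective_periodic_translation G q q0 Gm Gq Gs i.
  by rewrite -Gi -/(w i) -GP lexx ltNge -GP -ltNge; lia.
right.
have Gc' a k : G a <> c + k * q%:Z.
  have P (n : nat) i : G (i + n%:Z * q%:Z) = G i + n%:Z * q%:Z.
    elim: n => [|n IH]; first by rewrite !mul0r !addr0.
    rewrite (_ : i + n.+1%:Z * q%:Z = i + n%:Z * q%:Z + q%:Z); last by lia.
    by rewrite Gq IH; lia.
  move=> E; case: (leP 0 k) => k0.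
    apply: (Gc (a - k * q%:Z)); have := P `|k|%N (a - k * q%:Z).
    by rewrite gez0_abs // subrK E => /addIr.
  apply: (Gc (a - k * q%:Z)); have := P `|k|%N a.
  by rewrite ltz0_abs // mulNr E => ->; rewrite addrK.
pose g' v := w (G (C v)).
have g'1 : degree_one g'.
  split=> [u v uv | v]; rewrite /g'.
    by rewrite wm; apply: Gm; rewrite HC; apply: le_trans uv _; rewrite -HC.
  have -> : C (v + 1) = C v + q%:Z.
    apply: periodic_ge => j; rewrite HC -[in RHS]lerBrDr HC -[in LHS]lerBrDr.
    by have := wq (j - q%:Z); rewrite subrK => ->; rewrite addrK.
  by rewrite Gq wq.
have Cw a : C (w a) = a.
  apply/le_anti/andP; split; first by rewrite HC.
  by rewrite -wm -HC.
(* From [z (G a) <= w a = g (z a)] one gets [z (G^n 0) <= g^n (z 0)]. One more [g] gives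
   [w (G^n 0) <= g^(n+1) (z 0)], whence the extra [s] in the constant. *)
have g's : rot_ub g' s.
  have [D HD] := gs (z 0).
  apply: (@rot_ub_of_orbit _ g' s (w 0) (s + D)) => // n.
  have -> : iter n g' (w 0) = w (iter n G 0).
    by elim: n => //= n ->; rewrite /g' Cw.
  have := HD n.+1; rewrite -natr1 mulrDl mul1r -addrA; apply: le_trans.
  rewrite iterS; apply: g1.1.
  elim: n => //= n IH; have : z (G (iter n G 0)) <= w (iter n G 0) by rewrite -GP.
  by move=> H; apply: le_trans H _; apply: g1.1.
(* [E] is the action of [f \o g'] on the indices of [z]. As [E i >= i + p], a periodic point of [E]
   modulo [q] yields a rotation number at least [p/q]. *)
pose E i := G (C (z i)) + p.
have fg'z i : f (g' (z i)) = z (E i) by rewrite /g' /w fgz.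
have E_ge i : i + p <= E i.
  by rewrite lerD2r GP -HC.
have [|i [k [m m0 Em]]] := periodic_point_missing_class E q (c + p) q0.
  by move=> a k H; apply: (Gc' (C (z a)) k); move: H; rewrite /E; lia.
exists g', (z i), m, k; split => //.
  have -> n : iter n (f \o g') (z i) = z (iter n E i).
    by elim: n => //= n ->; rewrite fg'z.
  by rewrite Em (periodic_addz z q _ _ zq).
have : i + p * m%:Z <= iter m E i.
  elim: m {m0 Em} => [|m IH]; first by rewrite mulr0 addr0.
  by rewrite iterS; apply: le_trans (E_ge _); move: IH; lia.
by rewrite Em lerD2l.
Qed.

(** Strong induction on [q] with [f] fixed. Of [g] only the bound [s] on its growth is carried
    along, because its replacement may be discontinuous. *)
Lemma composition_orbit_bound {R : realType} (r s : R) (f g : R -> R) (x : R)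
    (p q : nat) :
  degree_one f -> degree_one g -> rot_ub f r -> rot_ub g s ->
  (0 < p)%N -> (0 < q)%N -> iter q (f \o g) x = x + p%:R ->
  exists (q' : nat) (p1 p2 : int),
    [/\ (0 < q')%N, p1%:~R / q'%:R <= r, p2%:~R / q'%:R <= s &
        p%:R / q%:R <= (p1 + p2 + 1)%:~R / q'%:R :> R].
Proof.
move=> f1; elim/ltn_ind: q g x p => q IH g x p g1 fr gs p0 q0 hx.
have h1 := degree_one_comp f g f1 g1.
have descend g' y q' (p' : nat) : degree_one g' -> rot_ub g' s -> (0 < q' < q)%N ->
    iter q' (f \o g') y = y + p'%:R -> (p * q' <= p' * q)%N ->
    exists (q' : nat) (p1 p2 : int),
    [/\ (0 < q')%N, p1%:~R / q'%:R <= r, p2%:~R / q'%:R <= s &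
        p%:R / q%:R <= (p1 + p2 + 1)%:~R / q'%:R :> R].
  move=> g'1 g's /andP[q'0 q'q] hy pq.
  have [|Q [p1 [p2 [Q0 h2 h3 h4]]]] := IH q' q'q g' y p' g'1 fr g's _ q'0 hy; first by nia.
  exists Q, p1, p2; split => //; apply: le_trans h4.
  by rewrite ler_pdivrMr ?ltr0n // mulrAC ler_pdivlMr ?ltr0n // -!natrM ler_nat.
have [cpq|ncpq] := boolP (coprime p q); last first.
  pose d := gcdn p q; have d0 : (0 < d)%N by rewrite gcdn_gt0 p0.
  have d1 : (1 < d)%N by move: ncpq; rewrite /coprime -/d; lia.
  have pE : p = (p %/ d * d)%N by rewrite divnK // dvdn_gcdl.
  have qE : q = (d * (q %/ d))%N by rewrite mulnC divnK // dvdn_gcdr.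
  set q' := (q %/ d)%N in qE; set p' := (p %/ d)%N in pE.
  apply: (descend g x q' p') => //; [by nia | | by rewrite {1}pE {1}qE mulnA].
  (* With a common factor [d] the orbit already closes after [q/d] steps: [y^d] fixes [x], hence so
     does the monotone map [y]. *)
  pose y v := iter q' (f \o g) v - p'%:R.
  have hn1 k := degree_one_iter (f \o g) k h1.
  have ym : {homo y : u v / u <= v}.
    by move=> u v uv; rewrite /y lerD2r; apply: (hn1 q').1.
  have iter_y k v : iter k y v = iter (k * q') (f \o g) v - (k * p')%:R.
    elim: k => [|k IHk]; first by rewrite subr0.
    rewrite iterS IHk /y.
    have := degree_one_addz _ (iter (k * q') (f \o g) v) (- (k * p')%:Z) (hn1 q').
    rewrite mulrNz -pmulrn => ->; rewrite mulSn iterD mulSn natrD.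
    by lra.
  suff /eqP : y x = x by rewrite /y subr_eq => /eqP.
  apply: (@fixed_of_iter_fixed _ y x d.-1) => //; rewrite prednK // iter_y -qE hx.
  by rewrite mulnC -pE addrK.
have [z [zS zq hz]] := rotation_orbit (f \o g) x p q h1 p0 q0 cpq hx.
have [[k kP]|[g' [y [m [p' [g'1 g's mq hy pp']]]]]] :=
    translation_or_shorter_orbit f g s z q p%:Z f1 g1 gs q0 zS zq hz; last first.
  have p'0 : 0 <= p' by nia.
  apply: (descend g' y m `|p'|%N) => //; last by nia.
  by rewrite hy -[in LHS](gez0_abs p'0).
(* Put [j = i + p - k - 1]. Then [g (z j) < z (j + k + 1) = z (i + p) = f (g (z i))], so [f]
   advances the points [g (z i)] by at least [p - k - 1] places. The place lost is the [+ 1] of the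
   formula. *)
exists q, (p%:Z - k - 1), k; split => //.
- apply: (@rot_ub_ge _ f r (g (z 0))) => //.
  have step i : g (z (i + (p%:Z - k - 1))) <= f (g (z i)).
    have /= -> := hz i; have /andP[_ /ltW] := kP (i + (p%:Z - k - 1)).
    by rewrite (_ : _ + k + 1 = i + p%:Z) //; lia.
  have orbit n : g (z (n%:Z * (p%:Z - k - 1))) <= iter n f (g (z 0)).
    elim: n => [|n IHn]; first by rewrite mul0r.
    rewrite iterS (_ : n.+1%:Z * _ = n%:Z * (p%:Z - k - 1) + (p%:Z - k - 1)); last by lia.
    by apply: le_trans (step _) _; apply: f1.1.
  apply: le_trans (orbit q); rewrite mulrC.
  have := periodic_addz z q 0 (p%:Z - k - 1) zq; rewrite add0r => ->.
  by rewrite degree_one_addz.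
- apply: (@rot_ub_ge _ g s (z 0)) => //.
  have orbit n : z (n%:Z * k) <= iter n g (z 0).
    elim: n => [|n IHn]; first by rewrite mul0r.
    rewrite iterS (_ : n.+1%:Z * _ = n%:Z * k + k); last by lia.
    by have /andP[+ _] := kP (n%:Z * k) => /le_trans; apply; apply: g1.1.
  apply: le_trans (orbit q); rewrite mulrC.
  by have := periodic_addz z q 0 k zq; rewrite add0r => ->.
- by rewrite (_ : p%:Z - k - 1 + k + 1 = p%:Z) //; lia.
Qed.

(** * Rotation numbers of homeomorphisms *)

Lemma lh_degree_one {R : realType} (f : lifthomeo R) : degree_one f.
Proof.
split; last exact: lh_add1.
by move=> x y; rewrite le_eqVlt => /orP[/eqP->//|/(@lh_incr _ f)/ltW].
Qed.

Lemma lh_expE {R : realType} (f : lifthomeo R) (n : nat) (x : R) :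
  (f ^+ n)%g x = iter n f x.
Proof. by elim: n => [|n IH] //; rewrite lh_expS IH. Qed.

(** Letting [m] tend to infinity in [rot_seq_cauchy] leaves an error [1/n] in the quotient, hence 1
    in the orbit, uniformly in [f] and [n]. *)
Lemma rot_orbit_dist {R : realType} (f : lifthomeo R) (n : nat) :
  `|iter n f 0 - n%:R * Defs.rot f| <= 1.
Proof.
case: n => [|n]; first by rewrite mul0r subr0 normr0.
have n0 : 0 < n.+1%:R :> R by rewrite ltr0n.
have H : `|rot_seq f 0 n.+1 - Defs.rot f| <= n.+1%:R^-1 + 0.
  apply: (@ler_cvg_to _ \oo _ R (fun m => `|rot_seq f 0 n.+1 - rot_seq f 0 m.+1|)
    (fun m => n.+1%:R^-1 + m.+1%:R^-1)).
  - apply: cvg_norm; apply: cvgB; first exact: cvg_cst.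
    by rewrite (cvg_shiftS (rot_seq f 0)); exact: rot_cvg.
  - by apply: cvgD; [exact: cvg_cst | exact: cvg_harmonic].
  - by apply: nearW => m; exact: rot_seq_cauchy.
move: H; rewrite /rot_seq subr0 addr0 lh_expE.
have -> : iter n.+1 f 0 / n.+1%:R - Defs.rot f =
  (iter n.+1 f 0 - n.+1%:R * Defs.rot f) / n.+1%:R by field; rewrite gt_eqF.
rewrite normrM [X in _ * X]gtr0_norm ?invr_gt0 //.
by rewrite ler_pdivrMr // mulVf // gt_eqF.
Qed.

Lemma rot_ub_rot {R : realType} (f : lifthomeo R) : rot_ub f (Defs.rot f).
Proof.
apply: (@rot_ub_of_orbit _ f _ 0 1); first exact: lh_degree_one.
by move=> n; have := rot_orbit_dist f n; rewrite ler_norml => /andP[_]; lra.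
Qed.

Lemma rot_le {R : realType} (f : lifthomeo R) (v : R) : rot_ub f v -> Defs.rot f <= v.
Proof.
move=> /(_ 0)[C H]; apply: (@le_of_nat_mul _ _ _ (C + 1)) => n.
by have := H n; have := rot_orbit_dist f n; rewrite ler_norml => /andP[+ _]; lra.
Qed.

Lemma le_rot {R : realType} (f : lifthomeo R) (x : R) (q : nat) (p : int) :
  (0 < q)%N -> x + p%:~R <= iter q f x -> p%:~R / q%:R <= Defs.rot f.
Proof.
move=> q0 H.
exact: (rot_ub_ge f _ x q p (lh_degree_one f) (rot_ub_rot f) q0 H).
Qed.

Lemma rot_le_orbit {R : realType} (f : lifthomeo R) (q : nat) (p : int) :
  (0 < q)%N -> iter q f 0 <= p%:~R -> Defs.rot f <= p%:~R / q%:R.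
Proof.
move=> q0 H; rewrite ler_pdivlMr ?ltr0n //.
apply: (@le_of_nat_mul _ _ _ 1) => n.
have := @iter_addz_le _ f 0 q p n (lh_degree_one f); rewrite add0r => /(_ H).
have := rot_orbit_dist f (n * q); rewrite ler_norml add0r natrM intrM.
by move=> /andP[+ _]; lra.
Qed.

Lemma rot_eq {R : realType} (f : lifthomeo R) (x v : R) :
  (forall n, iter n f x = x + n%:R * v) -> Defs.rot f = v.
Proof.
move=> H; have f1 := lh_degree_one f; apply/le_anti/andP; split.
  apply: rot_le; apply: (@rot_ub_of_orbit _ f _ x x f1) => n.
  by rewrite H addrC.
have [C HC] := rot_ub_rot f x.
apply: (@le_of_nat_mul _ _ _ (C - x)) => n.
by have := HC n; rewrite H; lra.
Qed.

Lemma continuous_iter_shift {R : realType} (h : R -> R) (n : nat) (x : R) :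
  continuous h -> continuous (fun t : R => iter n (fun y => h y + t) x).
Proof.
move=> hc; elim: n => [|n IH] t /=; first exact: cvg_cst.
apply: cvgD; last exact: cvg_id.
exact: (@continuous_comp _ _ _ (fun t => iter n (fun y => h y + t) x) h t (IH t) (hc _)).
Qed.

(** Intermediate values in the added constant: adding [-|h 0|] keeps the orbit of 0 at or below
    [0 <= p], and adding 0 gives the hypothesis. *)
Lemma shift_to_periodic_orbit {R : realType} (h : R -> R) (q p : nat) :
  degree_one h -> continuous h -> p%:R <= iter q h 0 ->
  exists2 t, 0 <= t & iter q (fun y => h y - t) 0 = p%:R.
Proof.
move=> [hm h1] hc hp; pose M := `|h 0|.
have M0 : 0 <= M := normr_ge0 _.
have [|||c] := @IVT R (fun t => iter q (fun y => h y + t) 0) (- M) 0 p%:R.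
- by rewrite oppr_le0.
- exact/continuous_subspaceT/continuous_iter_shift.
- rewrite ge_min le_max; apply/andP; split; apply/orP; [left|right].
    apply: le_trans (ler0n _ p); apply: iter_le => [x y xy|] /=.
      by rewrite lerD2r; exact: hm.
    by rewrite subr_le0 ler_norm.
  apply: le_trans hp _; by apply: le_iter_homo => [x y xy|x|] //=; rewrite !addr0 ?hm.
rewrite in_itv /= => /andP[_ c0] ec; exists (- c); first by rewrite oppr_ge0.
by under eq_fun do rewrite opprK.
Qed.

(** The strict inequality forces the [q]-th iterate of 0 past [p]. Lowering [f] by a constant
    [t >= 0] makes it land on [p], and [rot f] still bounds the growth of the lowered map. *)
Lemma rot_mul_bound {R : realType} (f g : lifthomeo R) (p q : nat) :
  (0 < p)%N -> (0 < q)%N -> p%:R / q%:R < Defs.rot (f * g)%g ->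
  exists (q' : nat) (p1 p2 : int),
    [/\ (0 < q')%N, p1%:~R / q'%:R <= Defs.rot f, p2%:~R / q'%:R <= Defs.rot g &
        p%:R / q%:R <= (p1 + p2 + 1)%:~R / q'%:R :> R].
Proof.
move=> p0 q0 pq.
have f1 := lh_degree_one f; have g1 := lh_degree_one g.
have fg1 : degree_one (f \o g) := degree_one_comp f g f1 g1.
have [||t t0 ht] := shift_to_periodic_orbit (f \o g) q p fg1.
- by move=> x; apply: continuous_comp; exact: lh_cont.
- rewrite leNgt; apply/negP => lt; move: pq; rewrite ltNge => /negP; apply.
  exact: (@rot_le_orbit _ (f * g)%g q p q0 (ltW lt)).
apply: (composition_orbit_bound _ _ (fun y => f y - t) g 0 p q) => //.
- split=> [x y xy|x]; first by rewrite lerD2r; apply: f1.1.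
  by rewrite f1.2 addrAC.
- move=> x; have [C HC] := rot_ub_rot f x; exists C => n; apply: le_trans (HC n).
  by apply: le_iter_homo => //; [exact: f1.1 | move=> y; rewrite gerBl].
- exact: rot_ub_rot.
- by rewrite add0r -ht.
Qed.

(** * Pairs attaining the bound *)

Lemma increasing_bij_continuous {R : realType} (f g : R -> R) :
  cancel f g -> cancel g f -> {homo f : x y / x < y} -> continuous f.
Proof.
move=> fK gK finc x; have fmono := leW_mono (le_mono finc).
apply/cvgrPdist_lt => e e0.
have lt1 : g (f x - e) < x by rewrite -fmono gK gtrBl.
have lt2 : x < g (f x + e) by rewrite -fmono gK ltrDl.
near=> y; rewrite distrC ltr_norml ltrBlDl ltrBrDl.
apply/andP; split.
  rewrite -[ltLHS]gK fmono; near: y; exact: lt_nbhsr.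
rewrite -[ltRHS]gK fmono; near: y; exact: lt_nbhsl.
Unshelve. all: by end_near. Qed.

Lemma increasing_inverse {R : realType} (f g : R -> R) :
  cancel g f -> {homo f : x y / x < y} -> {homo g : x y / x < y}.
Proof. by move=> gK finc x y xy; rewrite -(leW_mono (le_mono finc)) !gK. Qed.

Definition lifthomeo_of_bij {R : realType} (f g : R -> R)
    (fK : cancel f g) (gK : cancel g f) (finc : {homo f : x y / x < y})
    (f1 : forall x, f (x + 1) = f x + 1) : lifthomeo R :=
  LiftHomeo fK gK (increasing_bij_continuous f g fK gK finc)
    (increasing_bij_continuous g f gK fK (increasing_inverse f g gK finc)) finc f1.

Lemma shift_lifthomeo {R : realType} (t : R) :
  exists f : lifthomeo R, forall x, f x = x + t.
Proof.
have fK : cancel (fun x : R => x + t) (fun x => x - t) by move=> x; rewrite addrK.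
have gK : cancel (fun x : R => x - t) (fun x => x + t) by move=> x; rewrite subrK.
have finc : {homo (fun x : R => x + t) : x y / x < y}.
  by move=> x y; rewrite ltrD2r.
have f1 x : x + 1 + t = x + t + 1 by rewrite addrAC.
by exists (lifthomeo_of_bij _ _ fK gK finc f1).
Qed.

Definition floor_lift {R : realType} (a : R -> R) (x : R) : R :=
  (Num.floor x)%:~R + a (x - (Num.floor x)%:~R).

Lemma floor_liftE {R : realType} (a : R -> R) (m : int) (t : R) :
  0 <= t < 1 -> floor_lift a (m%:~R + t) = m%:~R + a t.
Proof.
move=> t01; rewrite /floor_lift.
have -> : Num.floor (m%:~R + t) = m by apply: floor_def; rewrite intrD; lra.
by rewrite [_ + t]addrC addrK.
Qed.

Lemma floor_split {R : realType} (x : R) :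
  exists m : int, exists2 t, 0 <= t < 1 & x = m%:~R + t.
Proof.
exists (Num.floor x), (x - (Num.floor x)%:~R); last by rewrite addrC subrK.
by have := floor_itv x; rewrite intrD; lra.
Qed.

Lemma floor_liftK {R : realType} (a b : R -> R) :
  (forall t, 0 <= t < 1 -> 0 <= a t < 1) -> cancel a b ->
  cancel (floor_lift a) (floor_lift b).
Proof.
move=> a01 aK x; have [m [t t01 ->]] := floor_split x.
by rewrite (floor_liftE a) // floor_liftE ?a01 // aK.
Qed.

(* Composed with its conjugate by the half-unit shift, this homeomorphism sends
   [m + 3/4] to [m + 1 + 3/4], although both factors have fixed points. *)
Lemma expanding_lifthomeo {R : realType} :
  exists f : lifthomeo R, forall m : int,
    f m%:~R = m%:~R /\ f (m%:~R + 4^-1) = m%:~R + 3 / 4.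
Proof.
(* Slope 3 up to [1/4], then slope [1/3]: [a] fixes 0 and 1 and sends [1/4] to [3/4]. Its inverse is
   [b]. *)
pose a (t : R) := Num.min (3 * t) ((t + 2) / 3).
pose b (t : R) := Num.max (t / 3) (3 * t - 2).
have aK : cancel a b.
  by move=> t; rewrite /a; case: leP => ?; rewrite /b; case: leP => ?; lra.
have bK : cancel b a.
  by move=> t; rewrite /b; case: leP => ?; rewrite /a; case: leP => ?; lra.
have a01 t : 0 <= t < 1 -> 0 <= a t < 1.
  by rewrite /a; case: (leP (3 * t)) => ?; lra.
have b01 t : 0 <= t < 1 -> 0 <= b t < 1.
  by rewrite /b; case: (leP (t / 3)) => ?; lra.
have ainc t u : t < u -> a t < a u.
  by rewrite /a; case: (leP (3 * t)) => ?; case: (leP (3 * u)) => ?; lra.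
have finc : {homo floor_lift a : x y / x < y}.
  move=> x y; have [m [t t01 ->]] := floor_split x; have [n [u u01 ->]] := floor_split y.
  rewrite !floor_liftE //; have := a01 _ t01; have := a01 _ u01 => au at_.
  have [mn|mn|->] := ltgtP m n; last by rewrite !ltrD2l; exact: ainc.
    have : m%:~R + 1 <= n%:~R :> R by rewrite -[1]/(1%:~R) -intrD ler_int; lia.
    by lra.
  have : n%:~R + 1 <= m%:~R :> R by rewrite -[1]/(1%:~R) -intrD ler_int; lia.
  by lra.
have f1 x : floor_lift a (x + 1) = floor_lift a x + 1.
  have [m [t t01 ->]] := floor_split x.
  rewrite (_ : m%:~R + t + 1 = (m + 1)%:~R + t); last by rewrite intrD; lra.
  by rewrite !floor_liftE // intrD; lra.
exists (lifthomeo_of_bij _ _ (floor_liftK a b a01 aK) (floor_liftK b a b01 bK) finc f1).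
move=> m /=; split.
  rewrite -[X in floor_lift a X]addr0 floor_liftE ?lexx ?ltr01 //.
  by rewrite /a; case: leP => ?; lra.
by rewrite floor_liftE; [rewrite /a; case: leP => ? |]; lra.
Qed.

(** [A] is conjugated by [x |-> q x - c] and then shifted by [p/q]. If [A] fixes the integers, the
    points [(i + c)/q] move by exactly [p/q]. *)
Lemma rescaled_lifthomeo {R : realType} (A : lifthomeo R) (q : nat) (p : int) (c : R) :
  (0 < q)%N -> exists f : lifthomeo R,
    forall x, f x = (A (q%:R * x - c) + c + p%:~R) / q%:R.
Proof.
move=> q0; have q0' : 0 < q%:R :> R by rewrite ltr0n.
pose F x := (A (q%:R * x - c) + c + p%:~R) / q%:R.
pose G x := (lh_inv A (q%:R * x - c - p%:~R) + c) / q%:R.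
have FK : cancel F G.
  move=> x; rewrite /F /G mulrCA divff ?gt_eqF // mulr1.
  rewrite (_ : A _ + c + p%:~R - c - p%:~R = A (q%:R * x - c)); last by ring.
  by rewrite lh_funK subrK mulrC mulKf // gt_eqF.
have GK : cancel G F.
  move=> x; rewrite /F /G mulrCA divff ?gt_eqF // mulr1 addrK lh_invK.
  rewrite (_ : _ + c + p%:~R = q%:R * x); last by ring.
  by rewrite mulrC mulKf // gt_eqF.
have Finc : {homo F : x y / x < y}.
  move=> x y xy; rewrite /F ltr_pM2r ?invr_gt0 // !ltrD2r; apply: lh_incr.
  by rewrite ltrD2r ltr_pM2l.
have F1 x : F (x + 1) = F x + 1.
  rewrite /F (_ : _ - c = q%:R * x - c + q%:R); last by ring.
  by rewrite lh_addn; field; rewrite gt_eqF.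
by exists (lifthomeo_of_bij F G FK GK Finc F1).
Qed.

(** [rot] is within [1/N] of the [N]-th iterate of 0 divided by [N], uniformly in the map, and for
    fixed [N] that iterate depends continuously on [t]. *)
Lemma continuous_rot_shift {R : realType} (F : R -> lifthomeo R) (h : R -> R) :
  continuous h -> (forall t x, F t x = h x + t) ->
  continuous (fun t => Defs.rot (F t)).
Proof.
move=> hc FE t; apply/cvgrPdist_lt => e e0.
(* The 3 adds up an error 1 for each of the two rotation numbers and a variation below 1 of the
   [N]-th iterate. *)
pose N := (Num.bound (3 / e)).+1; have N0 : 0 < N%:R :> R by rewrite ltr0n.
have eN : 3 < e * N%:R.
  rewrite -ltr_pdivrMl // mulrC; apply: (lt_trans (unstable.ltr_bound _)).
  by rewrite ltr_nat.
have itE n u : iter n (F u) 0 = iter n (fun y => h y + u) 0.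
  by elim: n => //= n ->.
near=> u.
have : `|iter N (F t) 0 - iter N (F u) 0| < 1.
  rewrite !itE; near: u.
  by have /cvgrPdist_lt := continuous_iter_shift h N 0 hc t; apply.
have := rot_orbit_dist (F t) N; have := rot_orbit_dist (F u) N.
rewrite !ler_norml !ltr_norml => /andP[? ?] /andP[? ?] /andP[? ?].
by apply/andP; split; rewrite -(ltr_pM2r N0) ?mulNr mulrBl; lra.
Unshelve. all: by end_near. Qed.

Lemma raise_rot {R : realType} (f : lifthomeo R) (r : R) : Defs.rot f <= r ->
  exists2 g : lifthomeo R, forall x, f x <= g x & Defs.rot g = r.
Proof.
move=> fr.
have [T TE] := choice (@shift_lifthomeo R).
pose F t := (T t * f)%g.
have FE t x : F t x = f x + t by rewrite /F /= TE.
have F0 : F 0 = f.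
  apply: lifthomeo_inj; apply/funext => x.
  by have := FE 0 x; rewrite addr0.
(* At [t1] the point 0 moves by at least [c >= r] in one step, so the rotation number has reached
   [r]. *)
pose c := Num.bound r; pose t1 := `|f 0| + c%:R.
have t10 : 0 <= t1 by rewrite addr_ge0.
have [||t] := @IVT R (fun t => Defs.rot (F t)) 0 t1 r t10.
- exact/continuous_subspaceT/(continuous_rot_shift F f (@lh_cont _ f) FE).
- rewrite ge_min le_max; apply/andP; split; apply/orP; [left|right].
    by rewrite F0.
  have := le_rot (F t1) 0 1 c isT; rewrite divr1 [iter 1 _ _]FE add0r => H.
  apply: (le_trans (ltW (unstable.ltr_bound r))); apply: H.
  by rewrite /t1 -pmulrn; have := ler_norm (- f 0); rewrite normrN; lra.
rewrite in_itv /= => /andP[t0 _] Ft; exists (F t) => // x.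
by rewrite FE lerDl.
Qed.

Lemma rot_mul_attains {R : realType} (r s : R) (q : nat) (p1 p2 : int) :
  (0 < q)%N -> p1%:~R / q%:R <= r -> p2%:~R / q%:R <= s ->
  exists f g : lifthomeo R, [/\ Defs.rot f = r, Defs.rot g = s &
    (p1 + p2 + 1)%:~R / q%:R <= Defs.rot (f * g)%g].
Proof.
move=> q0 pr ps; have q0' : q%:R != 0 :> R by rewrite pnatr_eq0 -lt0n.
have [A AP] := @expanding_lifthomeo R.
have [f fE] := rescaled_lifthomeo A q p1 0 q0.
have [g gE] := rescaled_lifthomeo A q p2 2^-1 q0.
(* The orbit of [c/q] advances by exactly [p/q] at each step. *)
have fix_rot (h : lifthomeo R) p c : 
    (forall x, h x = (A (q%:R * x - c) + c + p%:~R) / q%:R) ->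
    Defs.rot h = p%:~R / q%:R.
  move=> hE; apply: (@rot_eq _ h (c / q%:R)); elim=> [|n IH].
    by rewrite mul0r addr0.
  rewrite iterS IH hE.
  rewrite (_ : _ * _ - c = (n%:Z * p)%:~R); last first.
    by rewrite intrM -pmulrn; field.
  by rewrite (AP _).1 intrM -pmulrn -natr1; field.
(* In units of [1/q]: [g] sends [m + 3/4] to [m + p2 + 1 + 1/4], crossing an integer, and [f] sends
   that to [m + p2 + 1 + p1 + 3/4]. The two expansions together gain the extra 1. *)
have fgE n : iter n (f \o g) (3 / 4 / q%:R) =
    3 / 4 / q%:R + (n%:Z * (p1 + p2 + 1))%:~R / q%:R.
  elim: n => [|n IH]; first by rewrite !mul0r addr0.
  rewrite iterS IH /= gE; set k := n%:Z * _.
  rewrite (_ : _ * _ - 2^-1 = k%:~R + 4^-1); last by field.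
  rewrite (AP _).2 fE.
  rewrite (_ : _ * _ - 0 = (k + p2 + 1)%:~R + 4^-1); last by rewrite !intrD; field.
  rewrite (AP _).2 (_ : n.+1%:Z * _ = k + (p1 + p2 + 1)); last by rewrite /k; lia.
  by rewrite !intrD; field.
have [f' ff' f'r] := raise_rot f r (eq_ind_r (fun v => v <= r) pr (fix_rot f p1 0 fE)).
have [g' gg' g's] := raise_rot g s (eq_ind_r (fun v => v <= s) ps (fix_rot g p2 _ gE)).
exists f', g'; split => //; apply: (@le_rot _ (f' * g')%g (3 / 4 / q%:R)) => //.
rewrite [leLHS](_ : _ = iter q (f \o g) (3 / 4 / q%:R)); last first.
  by rewrite fgE intrM -pmulrn; field.
apply: le_iter_homo => //.
  exact: (lh_degree_one (f' * g')%g).1.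
by move=> x /=; apply: le_trans (ff' _) _; apply: (lh_degree_one f').1.
Qed.

(** * The formula for the supremum *)

Theorem mainTheorem3 (R : realType) (r s : R)
    (hr : 0 <= r < 1) (hs : 0 <= s < 1) :
  maxrot (gen_a * gen_b)%g r s =
  ereal_sup [set y : \bar R | exists (q : nat) (p1 p2 : int),
    [/\ (0 < q)%N, p1%:~R / q%:R <= r, p2%:~R / q%:R <= s &
        y = ((p1 + p2 + 1)%:~R / q%:R)%:E]].
Proof.
set S := [set y | _].
apply/le_anti/andP; split; apply: ge_ereal_sup => y; last first.
  move=> [q [p1 [p2 [q0 pr ps ->]]]].
  have [f [g [fr gs fg]]] := rot_mul_attains r s q p1 p2 q0 pr ps.
  pose rho : UMagmaMorphism.type F2 (lifthomeo R) :=
    fg_lift (fun b : bool => if b then f else g).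
  have rhoa : rho gen_a = f by exact: fg_lift_gen.
  have rhob : rho gen_b = g by exact: fg_lift_gen.
  apply: (@le_trans _ _ (Defs.rot (rho (gen_a * gen_b)%g))%:E).
    by rewrite lee_fin gmulfM rhoa rhob.
  by apply: ereal_sup_ubound; exists rho => //=; rewrite rhoa rhob.
move=> [rho /= [ra rb] <-]; rewrite gmulfM.
set f := rho gen_a in ra *; set g := rho gen_b in rb *.
rewrite leNgt; apply/negP => lt.
(* Since [r] and [s] are nonnegative, [q = 1] with both numerators 0 is admissible. So the supremum
   is at least 1, which excludes minus infinity and makes the rational chosen below positive, as
   [rot_mul_bound] requires. *)
have S1 : (1%:E <= ereal_sup S)%E.
  apply: ereal_sup_ubound; exists 1%N, 0, 0; split => //.
  - by rewrite mul0r; case/andP: hr.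
  - by rewrite mul0r; case/andP: hs.
  - by rewrite !add0r divr1.
have ub e : S e -> (e <= ereal_sup S)%E by move=> Se; exact: ereal_sup_ubound.
case: (ereal_sup S) S1 lt ub => [v| |] //; rewrite lee_fin lte_fin => v1 lt ub.
(* A rational strictly between the supremum and the rotation number of the product is dominated by
   an element of [S], a contradiction. *)
have [u] := rat_in_itvoo lt; rewrite in_itv /= => /andP[vu u_rot].
have u0 : 0 < u by rewrite -(ltr0q R); lra.
have uE : ratr u = `|numq u|%:R / `|denq u|%:R :> R.
  rewrite /ratr !pmulrn !gez0_abs ?numq_ge0 ?ltW //.
move: vu u_rot; rewrite uE => vu u_rot.
have [||q [p1 [p2 [q0 h1 h2 h3]]]] := rot_mul_bound f g _ _ _ _ u_rot.
- by rewrite absz_gt0 numq_eq0 gt_eqF.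
- by rewrite absz_gt0 denq_eq0.
have /ub : S ((p1 + p2 + 1)%:~R / q%:R)%:E.
  by exists q, p1, p2; split => //; rewrite -?ra -?rb.
by rewrite lee_fin leNgt (lt_le_trans vu h3).
Qed.
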